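(* Let $P$ be a normal logic program. Then $P$ has a $\le_s$-minimal stable trap space, and $P$ has a $\le_s$-minimal supported trap space. Here a stable (resp. supported) trap space $I$ is $\le_s$-minimal if there is no stable (resp. supported) trap space $J$ with $J \le_s I$ and $J \neq I$.
   Context: Fix a first-order language with finitely many constant, function and predicate symbols. A normal logic program (NLP) $P$ is a finite set of rules $p \leftarrow p_1,\dots,p_m, \mathord{\sim} p_{m+1},\dots,\mathord{\sim} p_k$ ($k\ge m\ge 0$, atoms $p,p_i$, $\mathord{\sim}$ default negation). $\mathrm{HB}(P)$ is its Herbrand base (possibly infinite), $\mathrm{gr}(P)$ its ground instantiation; for a ground rule $r$, $\mathrm{head}(r)$ is its head, $B^+(r)=\{p_1,\dots,p_m\}$, $B^-(r)=\{p_{m+1},\dots,p_k\}$, and $\mathrm{bf}(r)=\bigwedge_{v\in B^+(r)}v\wedge\bigwedge_{v\in B^-(r)}\neg v$ (equal to $1$ if the body is empty). A three-valued interpretation is a map $I:\mathrm{HB}(P)\to\{0,1,\star\}$; it is two-valued if it never takes value $\star$, and two-valued interpretations are identified with subsets of $\mathrm{HB}(P)$ (the true atoms). For three-valued $I$, $[I]=\{J\subseteq \mathrm{HB}(P) : \forall a\in\mathrm{HB}(P),\ I(a)\neq\star\Rightarrow J(a)=I(a)\}$. The order $\le_s$ on $\{0,1,\star\}$ is given by $0<_s\star$, $1<_s\star$ (no other strict relations), extended pointwise; equivalently $I_1\le_s I_2$ iff $[I_1]\subseteq[I_2]$. Formulas are evaluated in three-valued (Kleene) logic: $\neg 1=0,\neg0=1,\neg\star=\star$,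 conjunction is minimum and disjunction is maximum w.r.t. $0<_t\star<_t1$. For $a\in\mathrm{HB}(P)$ and an interpretation $I$, $I(\mathrm{rhs}(a))$ is the $\le_t$-maximum of $I(\mathrm{bf}(r))$ over all $r\in\mathrm{gr}(P)$ with $\mathrm{head}(r)=a$, and $0$ if there is no such rule. For a two-valued $I$: $T_P(I)$ is the two-valued interpretation with $T_P(I)(a)=I(\mathrm{rhs}(a))$ for all $a$; $F_P(I)$ is the $\subseteq$-least model of the Gelfond–Lifschitz reduct of $\mathrm{gr}(P)$ w.r.t. $I$ (delete every rule having some $b\in B^-(r)$ with $b\in I$, then delete all remaining negative literals). A nonempty set $S$ of two-valued interpretations is a stable trap set if $\{F_P(I): I\in S\}\subseteq S$, and a supported trap set if $\{T_P(I): I\in S\}\subseteq S$. A three-valued interpretation $I$ is a stable (resp. supported) trap space if $[I]$ is a stable (resp. supported) trap set. *)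

(* Defs.v *)
From HB Require Import structures.
From mathcomp Require Import all_boot all_classical.

Set Implicit Arguments.
Unset Strict Implicit.
Unset Printing Implicit Defensive.

Local Open Scope classical_set_scope.

(* A first-order language; constants are the function symbols of arity 0. *)
Record language := Language {
  fsym : finType;
  farity : fsym -> nat;
  psym : finType;
  parity : psym -> nat
}.

Inductive term (L : language) (V : Type) : Type :=
| Var of V
| App (f : fsym L) of {ffun 'I_(farity f) -> term L V}.

Record atom (L : language) (V : Type) := Atom {
  asym : psym L;
  aargs : {ffun 'I_(parity asym) -> term L V}
}.

HB.instance Definition _ (L : language) (V : Type) := gen_eqMixin (atom L V).

(* head <- pos, ~ neg *)
Record rule (L : language) (V : Type) := Rule {
  head : atom L V;
  pos : seq (atom L V);
  neg : seq (atom L V)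
}.

Section Substitution.
Variables (L : language) (V W : Type) (s : V -> term L W).

Fixpoint term_subst (t : term L V) : term L W :=
  match t with
  | Var v => s v
  | App f ts => App [ffun i => term_subst (ts i)]
  end.

Definition atom_subst (p : atom L V) : atom L W :=
  Atom [ffun i => term_subst (aargs p i)].

Definition rule_subst (r : rule L V) : rule L W :=
  Rule (atom_subst (head r)) (map atom_subst (pos r)) (map atom_subst (neg r)).

End Substitution.

(* Ground syntax is syntax over the empty set of variables. *)
Notation herbrand_base L := (atom L void).
Notation ground_rule L := (rule L void).

(* The variable-free instances of the rules of P.  Substitutions range over
   all terms, not only ground ones, so that a rule without variables has itself
   as a ground instance even when the language has no constant; see grE for
   languages that have ground terms. *)
Definition gr (L : language) (P : set (rule L nat)) : set (ground_rule L) :=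
  [set g | exists2 r, P r & exists s : nat -> term L nat,
     rule_subst s r = rule_subst (@of_void (term L nat)) g].

Inductive tval := Zero | One | Star.

HB.instance Definition _ := gen_eqMixin tval.
HB.instance Definition _ := gen_choiceMixin tval.

Definition tneg (x : tval) : tval :=
  match x with Zero => One | One => Zero | Star => Star end.

(* Truth order: Zero < Star < One. *)
Definition le_t (x y : tval) : bool :=
  match x, y with
  | Zero, _ | _, One | Star, Star => true
  | _, _ => false
  end.

Definition tmin (x y : tval) : tval := if le_t x y then x else y.

Definition interp (L : language) := herbrand_base L -> tval.

Definition le_s_val (x y : tval) : Prop := x = y \/ y = Star.

Definition le_s (L : language) (I J : interp L) : Prop :=
  forall a, le_s_val (I a) (J a).

(* The identification of subsets of the Herbrand base with two-valued
   interpretations. *)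
Definition of_set (L : language) (J : set (herbrand_base L)) : interp L :=
  fun a => if `[< J a >] then One else Zero.

(* [I] *)
Definition completions (L : language) (I : interp L) :
    set (set (herbrand_base L)) :=
  [set J | forall a, I a <> Star -> of_set J a = I a].

(* I(bf(r)) *)
Definition bf (L : language) (I : interp L) (r : ground_rule L) : tval :=
  tmin (\big[tmin/One]_(b <- pos r) I b) (\big[tmin/One]_(b <- neg r) tneg (I b)).

(* le_t-greatest element of A, and Zero if A is empty. *)
Definition tmax (A : set tval) : tval :=
  xget Zero [set v | A v /\ forall w, A w -> le_t w v].

(* I(rhs(a)) *)
Definition rhs (L : language) (P : set (rule L nat)) (I : interp L)
    (a : herbrand_base L) : tval :=
  tmax [set bf I r | r in [set r | gr P r /\ head r = a]].

Definition TP (L : language) (P : set (rule L nat))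
    (J : set (herbrand_base L)) : set (herbrand_base L) :=
  [set a | rhs P (of_set J) a = One].

(* Gelfond-Lifschitz reduct *)
Definition reduct (L : language) (D : set (ground_rule L))
    (J : set (herbrand_base L)) : set (ground_rule L) :=
  [set Rule (head r) (pos r) [::] | r in
    [set r | D r /\ forall b, b \in neg r -> ~ J b]].

Definition model (L : language) (D : set (ground_rule L))
    (M : set (herbrand_base L)) : Prop :=
  forall r, D r -> (forall b, b \in pos r -> M b) ->
    (forall b, b \in neg r -> ~ M b) -> M (head r).

(* Least model of the reduct, obtained as the intersection of all its models;
   see FP_least. *)
Definition FP (L : language) (P : set (rule L nat))
    (J : set (herbrand_base L)) : set (herbrand_base L) :=
  \bigcap_(M in [set M | model (reduct (gr P) J) M]) M.

Definition stable_trap_set (L : language) (P : set (rule L nat))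
    (S : set (set (herbrand_base L))) : Prop :=
  S !=set0 /\ [set FP P J | J in S] `<=` S.

Definition supported_trap_set (L : language) (P : set (rule L nat))
    (S : set (set (herbrand_base L))) : Prop :=
  S !=set0 /\ [set TP P J | J in S] `<=` S.

Definition stable_trap_space (L : language) (P : set (rule L nat)) :
    set (interp L) :=
  [set I | stable_trap_set P (completions I)].

Definition supported_trap_space (L : language) (P : set (rule L nat)) :
    set (interp L) :=
  [set I | supported_trap_set P (completions I)].

Definition le_s_minimal (L : language) (Q : set (interp L)) (I : interp L) :
    Prop :=
  Q I /\ ~ (exists J, [/\ Q J, le_s J I & J <> I]).

Lemma FP_least (L : language) (P : set (rule L nat))
    (J : set (herbrand_base L)) :
  model (reduct (gr P) J) (FP P J) /\
  forall M, model (reduct (gr P) J) M -> FP P J `<=` M.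
Proof.
split; last by move=> M MM a; apply.
move=> _ [r rD <-] /= hpos _ M MM.
by apply: (MM _ (ex_intro2 _ _ r rD erefl)) => //= b /hpos; apply.
Qed.

Lemma tmaxP (A : set tval) :
  A !=set0 -> A (tmax A) /\ forall w, A w -> le_t w (tmax A).
Proof.
move=> [x Ax].
suff [v Av] : exists v, [set v | A v /\ forall w, A w -> le_t w v] v.
  exact: (xgetPex Zero (ex_intro _ v Av)).
have [A1|nA1] := pselect (A One); first by exists One; split=> // -[].
have [As|nAs] := pselect (A Star); first by exists Star; split=> // -[].
by exists x; split=> // -[].
Qed.

Lemma tmax0 : tmax set0 = Zero.
Proof. by apply: xgetPN => v [[]]. Qed.

Lemma of_set_TP (L : language) (P : set (rule L nat))
    (J : set (herbrand_base L)) (a : herbrand_base L) :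
  of_set (TP P J) a = rhs P (of_set J) a.
Proof.
have H s (F : herbrand_base L -> tval) : (forall b, F b <> Star) ->
    \big[tmin/One]_(b <- s) F b <> Star.
  by move=> HF; elim/big_ind: _ => // -[] [].
have nS b : of_set J b <> Star by rewrite /of_set; case: asboolP.
have nN b : tneg (of_set J b) <> Star by rewrite /of_set; case: asboolP.
have nR : rhs P (of_set J) a <> Star.
  rewrite /rhs; set A := (X in tmax X).
  have [->|/set0P/tmaxP[[r _ <-] _]] := eqVneq A set0; first by rewrite tmax0.
  rewrite /bf; have := H (pos r) _ nS; have := H (neg r) _ nN.
  by case: (\big[_/_]_(_ <- _) _); case: (\big[_/_]_(_ <- _) _).
by rewrite {1}/of_set; case: asboolP; rewrite /TP /=; case: rhs nR.
Qed.

Lemma le_sP (L : language) (I J : interp L) :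
  le_s I J <-> completions I `<=` completions J.
Proof.
split=> [IJ K KI a Ja|IJ a].
  by case: (IJ a) => [e|//]; rewrite -e; apply: KI; rewrite e.
have KI (u : tval) : (u <> Star) ->
    completions I [set b | I b = One \/ (I b = Star /\ u = One)].
  move=> nu b nb; rewrite /of_set; case: asboolP => /=; case: (I b) nb => //.
    by move=> _ [|[]].
  by move=> _ []; left.
have [e|ne] := pselect (J a = Star); [by right|left].
have := IJ _ (KI Zero ltac:(by [])) a ne; have := IJ _ (KI One ltac:(by [])) a ne.
rewrite /of_set; case: asboolP => /=; case: asboolP => /=; case: (I a) => //;
  try (by move=> + +; intuition congruence).
Qed.

Section SubstitutionTheory.
Variable L : language.

Lemma term_ffun_ind (V : Type) (Q : term L V -> Prop) :
  (forall v, Q (Var L v)) ->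
  (forall f (ts : {ffun 'I_(farity f) -> term L V}),
     (forall i, Q (ts i)) -> Q (App ts)) ->
  forall t, Q t.
Proof.
move=> QV QA; exact: (fix IH t := match t with
  | Var v => QV v | App f ts => QA f ts (fun i => IH (ts i)) end).
Qed.

Lemma term_subst_comp (U V W : Type) (s : U -> term L V) (s' : V -> term L W)
    (t : term L U) :
  term_subst s' (term_subst s t) = term_subst (fun u => term_subst s' (s u)) t.
Proof.
elim/term_ffun_ind: t => [//|f ts IH] /=.
by congr App; apply/ffunP => i; rewrite !ffunE.
Qed.

Lemma term_subst_id (V : Type) (t : term L V) : term_subst (@Var L V) t = t.
Proof.
elim/term_ffun_ind: t => [//|f ts IH] /=.
by congr App; apply/ffunP => i; rewrite !ffunE.
Qed.

Lemma rule_subst_comp (U V W : Type) (s : U -> term L V) (s' : V -> term L W)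
    (r : rule L U) :
  rule_subst s' (rule_subst s r) = rule_subst (fun u => term_subst s' (s u)) r.
Proof.
have H p : atom_subst s' (atom_subst s p) =
    atom_subst (fun u => term_subst s' (s u)) p.
  by congr Atom; apply/ffunP => i; rewrite !ffunE term_subst_comp.
by rewrite /rule_subst /= H -!map_comp; congr Rule; apply: eq_map => p /=.
Qed.

Lemma rule_subst_id (V : Type) (r : rule L V) : rule_subst (@Var L V) r = r.
Proof.
have H p : atom_subst (@Var L V) p = p.
  by case: p => p ts; congr Atom; apply/ffunP => i; rewrite ffunE term_subst_id.
by case: r => h p n; rewrite /rule_subst /= H !(eq_map H) !map_id.
Qed.

Lemma grE (P : set (rule L nat)) (t0 : term L void) :
  gr P = [set g | exists2 r, P r & exists s : nat -> term L void,
                    rule_subst s r = g].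
Proof.
apply/seteqP; split=> g [r Pr [s e]]; exists r => //.
  exists (fun v => term_subst (fun=> t0) (s v)).
  rewrite -rule_subst_comp e rule_subst_comp -[RHS]rule_subst_id.
  by congr rule_subst; apply/funext; case.
exists (fun v => term_subst (@of_void (term L nat)) (s v)).
by rewrite -rule_subst_comp e.
Qed.

End SubstitutionTheory.

(* Main.v *)
Require Import Defs.
From mathcomp Require Import all_boot all_classical.

Local Open Scope classical_set_scope.

(** Whatever the operator [f] on two-valued interpretations, the trap spaces of
    [f] are closed under infima of [le_s]-chains: the members of a chain agree
    wherever they are not [Star], so their infimum is an interpretation whose
    completions are the common completions of the members, a nonempty
    [f]-closed set.  Zorn's lemma concludes, with [f := FP P] and [f := TP P]. *)

(** Convertible to [stable_trap_space P] for [f := FP P] and to [supported_trap_space P] for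
    [f := TP P], so one existence proof serves both. *)
Definition trap_space {L : language}
    (f : set (herbrand_base L) -> set (herbrand_base L)) : set (interp L) :=
  [set I | completions I !=set0 /\
           [set f J | J in completions I] `<=` completions I].

Lemma completions_nonempty {L : language} (I : interp L) :
  completions I !=set0.
Proof.
by exists [set a | I a = One] => a; rewrite /of_set; case: asboolP => /=; case: (I a).
Qed.

Lemma le_s_refl {L : language} (I : interp L) : le_s I I.
Proof. by move=> a; left. Qed.

Lemma le_s_trans {L : language} (I J K : interp L) :
  le_s I J -> le_s J K -> le_s I K.
Proof. by rewrite !le_sP; exact: subset_trans. Qed.

Lemma le_s_anti {L : language} (I J : interp L) :
  le_s I J -> le_s J I -> I = J.
Proof.
by move=> IJ JI; apply/funext => a; case: (IJ a) (JI a) => [//|->] [|->].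
Qed.

Lemma le_s_chain_inf {L : language} {C : set (interp L)} :
  total_on C (@le_s L) ->
  exists I : interp L, completions I = \bigcap_(K in C) completions K.
Proof.
move=> Ctot.
(* Totality makes [D a] at most a singleton. The default [Star] covers atoms where every member is
   [Star], and also the empty chain, whose intersection is the full set. *)
pose D a := [set v | v <> Star /\ exists2 K, C K & K a = v].
have DE a K : C K -> K a <> Star -> xget Star (D a) = K a.
  move=> CK KaS; have DK : D a (K a) by split=> //; exists K.
  case: xgetP => [v _ [vS [K' CK' e]]|/(_ _ DK)//]; rewrite -e in vS *.
  by case: (Ctot _ _ CK CK') => /(_ a) [].
exists (fun a => xget Star (D a)); apply/seteqP; split=> J JI.
  by move=> K CK a KaS; rewrite -(DE a K CK KaS); apply: JI; rewrite (DE a K).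
move=> a; case: xgetP => [v -> [vS [K CK e]] _|//].
by rewrite -e in vS *; exact: JI.
Qed.

Lemma trap_space_minimal {L : language}
    (f : set (herbrand_base L) -> set (herbrand_base L)) :
  exists I : interp L, le_s_minimal (trap_space f) I.
Proof.
pose T := {I : interp L | trap_space f I}.
(* The order is reversed: a maximal element for [R] is [le_s]-minimal. *)
pose R (s t : T) := `[< le_s (sval t) (sval s) >].
have [|||A RA|[I trapI] maxI] := @Zorn T R.
- by move=> s; apply/asboolP; exact: le_s_refl.
- move=> r s t /asboolP sr /asboolP ts; apply/asboolP; exact: le_s_trans ts sr.
- move=> [I trI] [J trJ] /asboolP JI /asboolP IJ; apply: eq_exist.
  exact: le_s_anti IJ JI.
- have Ctot : total_on [set sval s | s in A] (@le_s L).
    move=> _ _ [s As <-] [t At <-].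
    by case: (RA s t As At) => /asboolP; [right|left].
  have [I IE] := le_s_chain_inf Ctot.
  have trapI : trap_space f I.
    split; first exact: completions_nonempty.
    (* [J] completes every member of the chain; each member is closed under [f], so [f J] completes
       them all. *)
    move=> _ [J JI <-]; rewrite IE in JI *.
    move=> K CK; case: (CK) => s _ sK; have := svalP s; rewrite sK => -[_].
    by apply; exists J => //; exact: JI.
  exists (exist _ I trapI) => s As; apply/asboolP/le_sP => /=; rewrite IE.
  by apply: bigcap_inf; exists s.
- exists I; split=> // -[J [trapJ JI]]; apply.
  by have /(congr1 sval) := maxI (exist _ J trapJ) (asboolT JI).
Qed.

Theorem theorem3p1 (L : language) (P : set (rule L nat))
    (finP : finite_set P) :
  (exists I : interp L, le_s_minimal (stable_trap_space P) I) /\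
  (exists I : interp L, le_s_minimal (supported_trap_space P) I).
Proof.
split; [exact: (trap_space_minimal (FP P))|exact: (trap_space_minimal (TP P))].
Qed.
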